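(* Suppose that the maximal block Jacobi operator $J$ is self-adjoint. For any $\lambda\in\mathbb{R}$ there exists a unique function $\ell_\lambda:\mathbb{R}_+\to\mathbb{R}_+$ satisfying $$\|P(\lambda)\|_{[0,\ell_\lambda(\epsilon)]}\,\|Q(\lambda)\|_{[0,\ell_\lambda(\epsilon)]}=\frac{1}{2\epsilon},\qquad \epsilon>0.$$ Moreover, $\ell_\lambda$ is a strictly decreasing continuous function and satisfies $$\lim_{\epsilon\to0^+}\ell_\lambda(\epsilon)=+\infty,\qquad \lim_{\epsilon\to+\infty}\ell_\lambda(\epsilon)=0.$$ Consequently, its inverse $\ell_\lambda^{-1}$ is also a strictly decreasing continuous function and satisfies $$\lim_{t\to0^+}\ell_\lambda^{-1}(t)=+\infty,\qquad \lim_{t\to+\infty}\ell_\lambda^{-1}(t)=0.$$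
   Context: $\mathbb{R}_+=(0,+\infty)$. Let $d\in\mathbb{N}$, $\mathbb{N}_0=\{0,1,2,\dots\}$, and let $(A_n)_{n\ge0},(B_n)_{n\ge 0}$ be sequences in $M_d(\mathbb{C})$ with $\det A_n\ne0$ and $B_n=B_n^*$ for all $n\ge0$; put $A_{-1}:=-I$. $M_d(\mathbb{C})$ carries the operator norm. The formal block Jacobi operator acts on all sequences $u=(u_n)_{n\ge0}$ in $\mathbb{C}^d$ by $(\mathcal{J}u)_0=B_0u_0+A_0u_1$, $(\mathcal{J}u)_n=A_{n-1}^*u_{n-1}+B_nu_n+A_nu_{n+1}$ for $n\ge1$. The maximal block Jacobi operator $J$ in the Hilbert space $\ell^2(\mathbb{N}_0,\mathbb{C}^d)$ is the restriction of $\mathcal{J}$ to $\mathrm{Dom}(J)=\{u\in\ell^2(\mathbb{N}_0,\mathbb{C}^d):\mathcal{J}u\in\ell^2(\mathbb{N}_0,\mathbb{C}^d)\}$. For $z\in\mathbb{C}$, $P(z)=(P_n(z))_{n\ge-1}$ and $Q(z)=(Q_n(z))_{n\ge -1}$ are the $M_d(\mathbb{C})$-valued solutions of $A_{n-1}^*U_{n-1}+B_nU_n+A_nU_{n+1}=zU_n$, $n\ge0$, with $P_{-1}=0,\ P_0=I$ and $Q_{-1}=I,\ Q_0=0$. For a matrix sequence $X$ and $t\ge0$, with $\{t\}=t-\lfloor t\rfloor$, $$\|X\|_{[0,t]}:=\Big(\sum_{k=0}^{\lfloor t\rfloor}\|X_k\|^2+\{t\}\,\|X_{\lfloor t\rfloor+1}\|^2\Big)^{1/2}.$$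 *)

(* Defs.v *)
From HB Require Import structures.
From mathcomp Require Import all_boot all_order all_algebra.
From mathcomp Require Export sesquilinear spectral complex.
From mathcomp Require Import all_classical all_reals all_analysis.

Set Implicit Arguments.
Unset Strict Implicit.
Unset Printing Implicit Defensive.
Import Order.TTheory GRing.Theory Num.Theory numFieldNormedType.Exports.

Local Open Scope classical_set_scope.
Local Open Scope ring_scope.
Local Open Scope sesquilinear_scope.

(* [n |-> u_{n-1}], where [x] plays the role of the term of index -1. *)
Definition shift_seq (T : Type) (x : T) (u : nat -> T) (n : nat) : T :=
  if n is k.+1 then u k else x.

Section Euclidean.
Variables (R : realType) (d : nat).
Implicit Types (x y : 'cV[R[i]]_d) (M : 'M[R[i]]_d).

Definition vdot x y : R[i] := \sum_(i < d) x i 0 * (y i 0)^*.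

Definition vnorm x : R := Num.sqrt (\sum_(i < d) ComplexField.Normc.normc (x i 0) ^+ 2).

Definition opnorm M : R :=
  sup [set vnorm (M *m x) | x in [set x | vnorm x <= 1]].

End Euclidean.

Section SquareSummable.
Variables (R : realType) (d : nat).
Implicit Types u v w : nat -> 'cV[R[i]]_d.

Definition l2 : set (nat -> 'cV[R[i]]_d) :=
  [set u | cvgn (series (fun n => vnorm (u n) ^+ 2))].

Definition l2norm u : R :=
  Num.sqrt (limn (series (fun n => vnorm (u n) ^+ 2))).

(* Linear in the first argument; the series converges absolutely when both
   arguments are in l2, and its sum is taken componentwise. *)
Definition l2dot u v : R[i] :=
  Complex (limn (series (fun n => complex.Re (vdot (u n) (v n)))))
          (limn (series (fun n => complex.Im (vdot (u n) (v n))))).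

Definition l2dense (D : set (nat -> 'cV[R[i]]_d)) : Prop :=
  forall v, l2 v -> forall e : R, 0 < e ->
    exists2 u, D u & l2norm (fun n => v n - u n) < e.

(* An unbounded operator is given by its domain [D] and by an action [T], of
   which only the values on [D] matter. [adjoint_graph D T] is the graph of the
   Hilbert space adjoint, single-valued as soon as [D] is dense. *)
Definition adjoint_graph (D : set (nat -> 'cV[R[i]]_d))
    (T : (nat -> 'cV[R[i]]_d) -> nat -> 'cV[R[i]]_d) v w : Prop :=
  [/\ l2 v, l2 w & forall u, D u -> l2dot (T u) v = l2dot u w].

Definition selfadjoint (D : set (nat -> 'cV[R[i]]_d))
    (T : (nat -> 'cV[R[i]]_d) -> nat -> 'cV[R[i]]_d) : Prop :=
  l2dense D /\ forall v w, (D v /\ T v = w) <-> adjoint_graph D T v w.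

End SquareSummable.

Section BlockJacobi.
Variables (R : realType) (d : nat) (A B : nat -> 'M[R[i]]_d).

Definition jacobi (u : nat -> 'cV[R[i]]_d) (n : nat) : 'cV[R[i]]_d :=
  if n is k.+1 then
    (A k)^t* *m u k + B k.+1 *m u k.+1 + A k.+1 *m u k.+2
  else B 0%N *m u 0%N + A 0%N *m u 1%N.

Definition jacobi_dom : set (nat -> 'cV[R[i]]_d) :=
  [set u | l2 u /\ l2 (jacobi u)].

(* [Um1] is the term U_{-1} of the solution, and A_{-1} = - I. *)
Definition jacobi_solution (z : R[i]) (Um1 : 'M[R[i]]_d)
    (U : nat -> 'M[R[i]]_d) : Prop :=
  forall n, (shift_seq (- 1%:M) A n)^t* *m shift_seq Um1 U n
            + B n *m U n + A n *m U n.+1 = z *: U n.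

End BlockJacobi.

Definition interval_norm (R : realType) (d : nat) (X : nat -> 'M[R[i]]_d)
    (t : R) : R :=
  let n := Num.truncn t in
  Num.sqrt (\sum_(0 <= k < n.+1) opnorm (X k) ^+ 2
            + (t - n%:R) * opnorm (X n.+1) ^+ 2).

(* Main.v *)
Require Import Defs.
From HB Require Import structures.
From mathcomp Require Import all_boot all_order all_algebra.
From mathcomp Require Import sesquilinear spectral complex.
From mathcomp Require Import all_classical all_reals all_analysis.
From mathcomp Require Import ring lra.
Import Order.TTheory GRing.Theory Num.Theory numFieldNormedType.Exports.
Local Open Scope classical_set_scope.
Local Open Scope ring_scope.
Local Open Scope sesquilinear_scope.
Set Implicit Arguments.
Unset Strict Implicit.
Unset Printing Implicit Defensive.

(** Put h(t) = ||P||_[0,t] ||Q||_[0,t] for t >= 0. Everything follows once h is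
    known to be a strictly increasing bijection of the half line fixing 0:
    ell is then the map sending eps to the preimage of 1/(2 eps), its inverse
    is 1/(2 h), and continuity and limits are automatic for mutually inverse
    decreasing maps of the open half line.

    On each [n, n+1] the square of h is a product of two affine functions, so
    h is continuous there. It is strictly increasing unless both slopes vanish
    or the moving factor is multiplied by zero. The factor of P is positive
    since P_0 = I, the factor of Q is positive from t = 1 on and grows on
    [0, 1] since Q_1 is nonzero, and P_n, Q_n never vanish together because
    solutions of the recurrence take arbitrary values at two consecutive
    indices ([solutions_span_data]). As Q_0 = 0, h(0) = 0.

    Self-adjointness enters only in the unboundedness of h. If h were bounded,
    both factors would be bounded, and P x, Q x would be square summable for
    every vector x. But J(P x) = lambda P x, while J(Q x) = lambda Q x + x at
    index 0, because A_{-1} = - I feeds Q_{-1} = I into the first equation.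
    Symmetry of J then gives
    lambda <P x, Q x> = lambda <P x, Q x> + <P_0 x, x>, that is x = 0
    ([selfadjoint_not_both_l2]). *)

(** * Monotone functions on the half line *)

Lemma decreasing_cancel (R : realType) (f g : R -> R)
    (gpos : {homo g : x / 0 < x})
    (fdec : {in Num.pos &, {homo f : x y /~ x < y}})
    (gK : {in Num.pos, cancel g f}) :
  {in Num.pos &, {homo g : x y /~ x < y}}.
Proof.
move=> x y; rewrite !posrE => x0 y0 xy; rewrite ltNge; apply/negP.
rewrite le_eqVlt => /predU1P[/(congr1 f)|/fdec].
  by rewrite !gK ?posrE// => yx; rewrite yx ltxx in xy.
by rewrite !gK ?posrE ?gpos// => /(_ isT isT) /ltW; rewrite leNgt xy.
Qed.

(** A monotone function whose range is an interval has no jumps: the preimages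
    g (f x - e') and g (f x + e') enclose a neighbourhood of x that f sends
    within e' of f x. *)
Lemma decreasing_bijection_continuous (R : realType) (f g : R -> R)
    (fpos : {homo f : x / 0 < x}) (gpos : {homo g : x / 0 < x})
    (fdec : {in Num.pos &, {homo f : x y /~ x < y}})
    (fK : {in Num.pos, cancel f g}) (gK : {in Num.pos, cancel g f}) :
  {within [set x | 0 < x], continuous f}.
Proof.
have gdec := decreasing_cancel gpos fdec gK.
rewrite continuous_open_subspace; last exact: open_gt.
move=> x; rewrite inE/= => x0; have fx0 := fpos _ x0.
apply/(@cvgrPdist_lt _ R^o) => e e0.
(* The bound f x / 2 keeps f x - e' in the domain of g. *)
pose e' := Num.min e (f x / 2).
have e'0 : 0 < e' by rewrite lt_min e0 divr_gt0.
have e'e : e' <= e by rewrite ge_min lexx.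
have lo0 : 0 < f x - e'.
  have : e' <= f x / 2 by rewrite ge_min lexx orbT.
  lra.
have hi0 : 0 < f x + e' by rewrite addr_gt0.
have xlo : x < g (f x - e').
  by rewrite -[ltLHS](fK x) ?posrE//; apply: gdec; rewrite ?posrE//; lra.
have xhi : g (f x + e') < x.
  by rewrite -[ltRHS](fK x) ?posrE//; apply: gdec; rewrite ?posrE//; lra.
near=> z.
have zhi : g (f x + e') < z by near: z; apply: lt_nbhsr.
have zlo : z < g (f x - e') by near: z; apply: lt_nbhsl.
have z0 : 0 < z by apply: lt_trans zhi; exact: gpos.
have := fdec _ _ _ _ zhi; have := fdec _ _ _ _ zlo.
rewrite !gK ?posrE ?gpos// => /(_ isT z0) h1 /(_ z0 isT) h2.
by rewrite ltr_norml; apply/andP; split; lra.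
Unshelve. all: by end_near. Qed.

Lemma decreasing_bijection_limits (R : realType) (f g : R -> R)
    (fpos : {homo f : x / 0 < x}) (gpos : {homo g : x / 0 < x})
    (fdec : {in Num.pos &, {homo f : x y /~ x < y}})
    (gK : {in Num.pos, cancel g f}) :
  f x @[x --> 0^'+] --> +oo /\ f x @[x --> +oo] --> 0.
Proof.
split.
- apply/cvgryPge => M; pose M' := Num.max M 1.
  have M'0 : 0 < M' by rewrite lt_max ltr01 orbT.
  near=> x.
  have x0 : 0 < x by near: x; exact: nbhs_right_gt.
  have xg : x < g M' by near: x; apply: nbhs_right_lt; exact: gpos.
  have := fdec _ _ _ _ xg.
  rewrite gK ?posrE ?gpos// => /(_ isT x0) /ltW; apply: le_trans.
  by rewrite le_max lexx.
- apply/(@cvgrPdist_lt _ R^o) => e e0; near=> x.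
  have xg : g e < x by near: x; apply: nbhs_pinfty_gt; exact: num_real.
  have x0 : 0 < x by apply: lt_trans xg; exact: gpos.
  have := fdec _ _ _ _ xg; rewrite gK ?posrE ?gpos// => /(_ x0 isT).
  by rewrite sub0r normrN gtr0_norm// fpos.
Unshelve. all: by end_near. Qed.

(** Strict monotonicity is local, so it can be checked where the interval norm
    has a single affine expression under the root. *)
Lemma increasing_of_unit_intervals (R : realType) (h : R -> R)
    (hinc : forall n : nat, {in `[n%:R, n.+1%:R] &, {homo h : s t / s < t}}) :
  {in Num.nneg &, {homo h : s t / s < t}}.
Proof.
have hnat : {homo (fun n : nat => h n%:R) : m n / (m <= n)%N >-> m <= n}.
  apply: homo_leq => // [y x z|n]; first exact: le_trans.
  by apply/ltW/(hinc n); rewrite ?in_itv/= ?lexx ?ler_nat ?ltr_nat ?leqnSn.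
have hle n : {in `[n%:R, n.+1%:R] &, {homo h : s t / s <= t}}.
  move=> s t sn tn; rewrite le_eqVlt => /predU1P[->//|st].
  exact/ltW/(hinc n).
move=> s t; rewrite !nnegrE => s0 t0 st.
have /andP[sn sn1] := trunc_itv s0; have /andP[tm tm1] := trunc_itv t0.
set n := Num.trunc s in sn sn1; set m := Num.trunc t in tm tm1.
have [mn|nm] := leqP m n.
  apply: (hinc n) => //; rewrite in_itv/= ?sn ?(ltW sn1)//.
  rewrite (le_trans sn (ltW st))/=; apply/ltW/(lt_le_trans tm1).
  by rewrite ler_nat.
apply: (@lt_le_trans _ _ (h n.+1%:R)).
  by apply: (hinc n); rewrite ?in_itv/= ?sn ?(ltW sn1) ?lexx ?ler_nat ?leqnSn.
apply: (le_trans (hnat _ _ nm)).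
by apply: (hle m); rewrite ?in_itv/= ?tm ?(ltW tm1) ?lexx ?ler_nat ?leqnSn.
Qed.

(** The intermediate value theorem on the first unit interval at whose right
    end h reaches y. *)
Lemma surjective_of_unit_intervals (R : realType) (h : R -> R)
    (hcont : forall n : nat, {within `[n%:R, n.+1%:R], continuous h})
    (h0 : h 0 = 0) (hunb : forall y, exists n : nat, y <= h n%:R) y :
  0 < y -> exists2 t, 0 < t & h t = y.
Proof.
move=> y0.
have [[|n] yn nmin] := ex_minnP (hunb y).
  by move: yn; rewrite h0 leNgt y0.
have hn : h n%:R < y.
  by rewrite ltNge; apply/negP => /nmin; rewrite ltnn.
have [||t] := IVT (v := y) _ (hcont n).
- by rewrite ler_nat.
- by rewrite ge_min (ltW hn) le_max yn orbT.
rewrite in_itv/= => /andP[nt _] hty; exists t => //.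
rewrite lt_neqAle (le_trans (ler0n _ n) nt) andbT; apply/eqP => t0.
by move: hty y0; rewrite -t0 h0 => <-; rewrite ltxx.
Qed.

(** * Euclidean and operator norms *)

Lemma vnorm_ge0 (R : realType) (d : nat) (x : 'cV[R[i]]_d) : 0 <= vnorm x.
Proof. exact: sqrtr_ge0. Qed.

Lemma sqr_vnorm (R : realType) (d : nat) (x : 'cV[R[i]]_d) :
  vnorm x ^+ 2 = \sum_(i < d) ComplexField.Normc.normc (x i 0) ^+ 2.
Proof. by rewrite sqr_sqrtr// sumr_ge0// => i _; exact: sqr_ge0. Qed.

Lemma normc_ge0 (R : realType) (z : R[i]) : 0 <= ComplexField.Normc.normc z.
Proof. by case: z => a b; exact: sqrtr_ge0. Qed.

Lemma vnormZ (R : realType) (d : nat) (c : R[i]) (x : 'cV[R[i]]_d) :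
  vnorm (c *: x) = ComplexField.Normc.normc c * vnorm x.
Proof.
rewrite /vnorm -[X in X * _]ger0_norm ?normc_ge0// -sqrtr_sqr -sqrtrM ?sqr_ge0//.
congr Num.sqrt; rewrite mulr_sumr; apply: eq_bigr => i _.
by rewrite mxE ComplexField.Normc.normcM exprMn.
Qed.

Lemma vnorm_eq0 (R : realType) (d : nat) (x : 'cV[R[i]]_d) :
  vnorm x = 0 -> x = 0.
Proof.
move=> x0; have /eqP := sqr_vnorm x; rewrite x0 expr0n eq_sym.
rewrite psumr_eq0 => [/allP x0i|i _]; last exact: sqr_ge0.
apply/colP => i; rewrite mxE; apply: ComplexField.Normc.eq0_normc.
by apply/eqP; have := x0i i (mem_index_enum i); rewrite sqrf_eq0.
Qed.

Lemma vnorm0 (R : realType) (d : nat) : vnorm (0 : 'cV[R[i]]_d) = 0.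
Proof. by rewrite -(scale0r 0) vnormZ ComplexField.Normc.normc0 mul0r. Qed.

Lemma normc_le_vnorm (R : realType) (d : nat) (x : 'cV[R[i]]_d) i :
  ComplexField.Normc.normc (x i 0) <= vnorm x.
Proof.
rewrite -(@ler_pXn2r _ 2) ?nnegrE ?normc_ge0 ?vnorm_ge0// sqr_vnorm.
by rewrite (bigD1 i)//= lerDl sumr_ge0// => j _; exact: sqr_ge0.
Qed.

Lemma normc_sum (R : realType) (I : finType) (F : I -> R[i]) :
  ComplexField.Normc.normc (\sum_i F i)
    <= \sum_i ComplexField.Normc.normc (F i).
Proof.
elim/big_ind2 : _ => [|x a y b xa yb|//].
  by rewrite ComplexField.Normc.normc0.
exact: le_trans (le_normcD _ _) (lerD xa yb).
Qed.

Lemma opnorm_set_bounded (R : realType) (d : nat) (M : 'M[R[i]]_d) :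
  has_ubound [set vnorm (M *m x) | x in [set x | vnorm x <= 1]].
Proof.
exists (Num.sqrt (\sum_(i < d)
  (\sum_(j < d) ComplexField.Normc.normc (M i j)) ^+ 2)) => _ [x /= x1 <-].
apply: ler_wsqrtr; apply: ler_sum => i _.
have S0 : 0 <= \sum_(j < d) ComplexField.Normc.normc (M i j).
  by apply: sumr_ge0 => j _; exact: normc_ge0.
rewrite ler_pXn2r ?nnegrE ?normc_ge0// mxE (le_trans (normc_sum _))//.
apply: ler_sum => j _; rewrite ComplexField.Normc.normcM.
rewrite -[leRHS]mulr1 ler_wpM2l ?normc_ge0//.
exact: le_trans (normc_le_vnorm x j) x1.
Qed.

Lemma vnorm_mulmx_le (R : realType) (d : nat) (M : 'M[R[i]]_d) x :
  vnorm (M *m x) <= opnorm M * vnorm x.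
Proof.
have [x0|x0] := eqVneq (vnorm x) 0.
  by rewrite (vnorm_eq0 x0) mulmx0 vnorm0 mulr0.
have x_gt0 : 0 < vnorm x by rewrite lt_neqAle eq_sym x0 vnorm_ge0.
(* Normalise x by the scalar 1 / vnorm x, seen as a complex number. *)
have nc : ComplexField.Normc.normc ((vnorm x)^-1%:C)%C = (vnorm x)^-1.
  by rewrite /= expr0n addr0 sqrtr_sqr ger0_norm// invr_ge0 vnorm_ge0.
rewrite -ler_pdivrMr// mulrC -nc -vnormZ scalemxAr.
apply: (ub_le_sup (opnorm_set_bounded M)).
by exists (((vnorm x)^-1%:C)%C *: x) => //=; rewrite vnormZ nc mulVf.
Qed.

Lemma opnorm_ge0 (R : realType) (d : nat) (M : 'M[R[i]]_d) : 0 <= opnorm M.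
Proof.
have := ub_le_sup (opnorm_set_bounded M); apply.
by exists 0; rewrite /= ?mulmx0 ?vnorm0.
Qed.

Lemma opnorm0 (R : realType) (d : nat) : opnorm (0 : 'M[R[i]]_d) = 0.
Proof.
rewrite /opnorm -[RHS]sup1; congr sup; apply/seteqP; split => [_ [x _ <-]|_ ->].
  by rewrite /= mul0mx vnorm0.
by exists 0; rewrite /= ?mul0mx ?vnorm0.
Qed.

Lemma opnorm_gt0 (R : realType) (d : nat) (M : 'M[R[i]]_d) :
  M != 0 -> 0 < opnorm M.
Proof.
move=> M_neq0; rewrite lt_neqAle opnorm_ge0 andbT eq_sym.
apply: contraNneq M_neq0 => M0; apply/eqP/matrixP => i j.
have : M *m delta_mx j 0 = 0 :> 'cV_d.
  apply/vnorm_eq0/eqP; rewrite eq_le vnorm_ge0 andbT.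
  by rewrite (le_trans (vnorm_mulmx_le _ _))// M0 mul0r.
by rewrite -colE => /colP/(_ i); rewrite !mxE.
Qed.

(** * The interval norm and the product of two interval norms *)

(** Includes the right endpoint t = n+1, where the truncation jumps but the
    two expressions agree. *)
Lemma interval_normE (R : realType) (d : nat) (X : nat -> 'M[R[i]]_d) n (t : R) :
  n%:R <= t <= n.+1%:R ->
  interval_norm X t = Num.sqrt (\sum_(0 <= k < n.+1) opnorm (X k) ^+ 2
                                + (t - n%:R) * opnorm (X n.+1) ^+ 2).
Proof.
case/andP => nt; rewrite le_eqVlt => /predU1P[->|tn]; last first.
  by rewrite /interval_norm (@truncn_def _ _ n) ?nt.
rewrite /interval_norm natrK subrr mul0r addr0.
have -> : n.+1%:R - n%:R = 1 :> R by rewrite mulrS addrK.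
by rewrite mul1r [LHS](congr1 Num.sqrt (big_nat_recr _ _ _ _)).
Qed.

Lemma interval_norm_continuous (R : realType) (d : nat) (X : nat -> 'M[R[i]]_d)
    n : {within `[n%:R, n.+1%:R], continuous (interval_norm X : R -> R)}.
Proof.
pose f (t : R) := Num.sqrt (\sum_(0 <= k < n.+1) opnorm (X k) ^+ 2
                      + (t - n%:R) * opnorm (X n.+1) ^+ 2).
have eqf : {in `[n%:R, n.+1%:R]%classic, f =1 interval_norm X}.
  by move=> t; rewrite inE/= in_itv/= => /interval_normE ->.
apply: (subspace_eq_continuous eqf); apply: continuous_subspaceT => t.
apply: continuous_comp; last exact: sqrt_continuous.
apply: (@cvgD _ R^o); first exact: cvg_cst.
apply: (@cvgM R); last exact: cvg_cst.
by apply: (@cvgB _ R^o); [exact: cvg_id|exact: cvg_cst].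
Qed.

(** The product of the affine functions grows by
    (a + s p)(t - s) q + (t - s) p (b + s q) + (t - s)^2 p q, where the
    hypothesis on the slopes makes one of the first two terms positive. *)
Lemma sqrt_affine_product_increasing (R : realType) (a b p q : R) (s t : R) :
  0 < a -> 0 <= b -> 0 <= p -> 0 <= q -> 0 < q \/ 0 < b /\ 0 < p ->
  0 <= s -> s < t ->
  Num.sqrt (a + s * p) * Num.sqrt (b + s * q)
    < Num.sqrt (a + t * p) * Num.sqrt (b + t * q).
Proof.
move=> a0 b0 p0 q0 pq s0 st.
have t0 : 0 < t by exact: le_lt_trans st.
rewrite -!sqrtrM ?addr_ge0 ?(ltW a0) ?mulr_ge0// ?(ltW t0)//.
have ats : 0 <= (t - s) * p by rewrite mulr_ge0// subr_ge0 ltW.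
have bts : 0 <= (t - s) * q by rewrite mulr_ge0// subr_ge0 ltW.
have sp : 0 <= s * p by rewrite mulr_ge0.
have sq : 0 <= s * q by rewrite mulr_ge0.
have key : (a + s * p) * (b + s * q) < (a + t * p) * (b + t * q).
  rewrite -subr_gt0.
  have -> : (a + t * p) * (b + t * q) - (a + s * p) * (b + s * q)
    = (a + s * p) * ((t - s) * q) + ((t - s) * p) * (b + s * q)
      + ((t - s) * p) * ((t - s) * q) by ring.
  have X0 : 0 <= (t - s) * p * ((t - s) * q) by rewrite mulr_ge0.
  have Y0 : 0 <= (t - s) * p * (b + s * q) by rewrite mulr_ge0// addr_ge0.
  have Z0 : 0 <= (a + s * p) * ((t - s) * q) by rewrite mulr_ge0// addr_ge0// ltW.
  case: pq => [q_gt0|[b_gt0 p_gt0]].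
    have : 0 < (a + s * p) * ((t - s) * q).
      by rewrite mulr_gt0// ?mulr_gt0 ?subr_gt0// ltr_pwDl.
    lra.
  have : 0 < (t - s) * p * (b + s * q).
    by rewrite mulr_gt0// ?mulr_gt0 ?subr_gt0// ltr_pwDl.
  lra.
rewrite ltr_sqrt//; apply: le_lt_trans key.
by rewrite mulr_ge0// addr_ge0// ltW.
Qed.

(** On [0, 1] only the slope of the second factor counts, its value at 0 being
    possibly zero; from 1 on both factors are positive and either slope
    suffices. *)
Lemma interval_norm_product_increasing (R : realType) (d : nat)
    (P Q : nat -> 'M[R[i]]_d) :
  P 0%N != 0 -> Q 1%N != 0 -> (forall n, (P n.+1 != 0) || (Q n.+1 != 0)) ->
  {in Num.nneg &,
    {homo (fun t : R => interval_norm P t * interval_norm Q t) : s t / s < t}}.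
Proof.
move=> P0 Q1 PQ; apply: increasing_of_unit_intervals => n s t.
rewrite !in_itv/= => sn tn st; rewrite !(interval_normE _ sn) !(interval_normE _ tn).
have S0 m (X : nat -> 'M[R[i]]_d) : 0 <= \sum_(0 <= k < m) opnorm (X k) ^+ 2.
  by apply: sumr_ge0 => k _; exact: sqr_ge0.
apply: sqrt_affine_product_increasing; rewrite ?sqr_ge0 ?S0 ?ltrD2r//.
- by rewrite big_nat_recl// ltr_pwDl ?S0// exprn_gt0// opnorm_gt0.
- have [/orP[p0|q0]] := PQ n; last by left; rewrite exprn_gt0// opnorm_gt0.
  case: n {sn tn} p0 => [|n] p0; first by left; rewrite exprn_gt0// opnorm_gt0.
  right; split; last by rewrite exprn_gt0// opnorm_gt0.
  rewrite big_nat_recl// ltr_wpDl ?sqr_ge0// big_nat_recl//.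
  by rewrite ltr_pwDl ?S0// exprn_gt0// opnorm_gt0.
- by rewrite subr_ge0; case/andP: sn.
Qed.

Lemma interval_norm_nat (R : realType) (d : nat) (X : nat -> 'M[R[i]]_d) n :
  interval_norm X (n%:R : R) = Num.sqrt (\sum_(0 <= k < n.+1) opnorm (X k) ^+ 2).
Proof.
by rewrite (@interval_normE _ _ _ n) ?lexx ?ler_nat ?leqnSn// subrr mul0r addr0.
Qed.

(** Both factors are nondecreasing and eventually bounded away from zero, so a
    bound on the product bounds each of them. *)
Lemma interval_norm_product_unbounded (R : realType) (d : nat)
    (P Q : nat -> 'M[R[i]]_d) :
  P 0%N != 0 -> Q 1%N != 0 ->
  ~ (cvgn (series (fun n => opnorm (P n) ^+ 2)) /\
     cvgn (series (fun n => opnorm (Q n) ^+ 2))) ->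
  forall y : R, exists n : nat, y <= interval_norm P (n%:R : R) * interval_norm Q n%:R.
Proof.
move=> P0 Q1 PQ y; apply: contrapT => /forallNP small; apply: PQ.
have S0 m (X : nat -> 'M[R[i]]_d) : 0 <= \sum_(0 <= k < m) opnorm (X k) ^+ 2.
  by apply: sumr_ge0 => k _; exact: sqr_ge0.
have prod_le n : (\sum_(0 <= k < n.+1) opnorm (P k) ^+ 2)
               * (\sum_(0 <= k < n.+1) opnorm (Q k) ^+ 2) <= y ^+ 2.
  have := small n; rewrite !interval_norm_nat -sqrtrM// => /negP.
  rewrite -ltNge => yn; rewrite -[leLHS]sqr_sqrtr ?mulr_ge0//.
  have s0 := sqrtr_ge0 ((\sum_(0 <= k < n.+1) opnorm (P k) ^+ 2)
               * (\sum_(0 <= k < n.+1) opnorm (Q k) ^+ 2)).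
  by rewrite ler_pXn2r ?nnegrE// ?(ltW yn)// (le_trans s0 (ltW yn)).
have p0 : 0 < opnorm (P 0%N) ^+ 2 by rewrite exprn_gt0// opnorm_gt0.
have q1 : 0 < opnorm (Q 1%N) ^+ 2 by rewrite exprn_gt0// opnorm_gt0.
have mono (X : nat -> 'M[R[i]]_d) :
    {homo series (fun n => opnorm (X n) ^+ 2) : m n / (m <= n)%N >-> m <= n}.
  by move=> m n mn; apply: (nondecreasing_series (fun k _ _ => sqr_ge0 _)).
split; apply: nondecreasing_is_cvgn => //.
- exists (y ^+ 2 / opnorm (Q 1%N) ^+ 2) => _ [n _ <-].
  apply: (le_trans (mono P _ _ (leq_trans (leqnSn n) (leqnSn _)))).
  rewrite ler_pdivlMr// (le_trans _ (prod_le n.+1))// ler_wpM2l ?S0//.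
  rewrite big_nat_recl// big_nat_recl//.
  by rewrite ler_wpDl ?sqr_ge0// lerDl S0.
- exists ((opnorm (P 0%N) ^+ 2)^-1 * y ^+ 2) => _ [n _ <-].
  apply: (le_trans (mono Q _ _ (leqnSn n))).
  rewrite (ler_pdivlMl _ _ p0); apply: le_trans (prod_le n).
  apply: ler_wpM2r; first exact: S0.
  by rewrite big_nat_recl// lerDl S0.
Qed.

(** * Solutions of the Jacobi recurrence *)

Lemma unitmx_adjoint (R : realType) (d : nat) (M : 'M[R[i]]_d) :
  \det M != 0 -> M^t* \in unitmx.
Proof. by move=> M0; rewrite map_unitmx unitmx_tr unitmxE unitfE. Qed.

Lemma unitmx_coef (R : realType) (d : nat) (A : nat -> 'M[R[i]]_d)
    (hA : forall n, \det (A n) != 0) n :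
  (shift_seq (- 1%:M) A n)^t* \in unitmx.
Proof.
case: n => [|n] /=; last exact: unitmx_adjoint.
by apply: unitmx_adjoint; rewrite -scaleN1r detZ det1 mulr1 expf_neq0// oppr_eq0 oner_eq0.
Qed.

(** The columns of P and Q form a fundamental system. In the induction step
    the values (X, Y) at the indices (n, n+1) are reached by prescribing at
    n-1 the value W that the recurrence forces, which needs A_{n-1}^*
    invertible; as A_n is invertible too, the combination with values (W, X)
    at (n-1, n) must take the value Y at n+1. *)
Lemma solutions_span_data (R : realType) (d : nat) (A B : nat -> 'M[R[i]]_d)
    (hA : forall n, \det (A n) != 0) (z : R[i]) (P Q : nat -> 'M[R[i]]_d)
    (hP : jacobi_solution A B z 0 P) (hP0 : P 0%N = 1%:M)
    (hQ : jacobi_solution A B z 1%:M Q) (hQ0 : Q 0%N = 0) n (X Y : 'M[R[i]]_d) :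
  exists C D, shift_seq 0 P n *m C + shift_seq 1%:M Q n *m D = X
              /\ P n *m C + Q n *m D = Y.
Proof.
elim: n X Y => [|n IH] X Y /=.
  by exists Y, X; rewrite hP0 hQ0 !mul1mx !mul0mx add0r addr0.
pose L := (shift_seq (- 1%:M) A n)^t*.
have Lu : L \in unitmx by exact: unitmx_coef.
pose W := invmx L *m (z *: X - B n *m X - A n *m Y).
have [C [D [CDW CDX]]] := IH W X.
exists C, D; split => //.
have Au : A n \in unitmx by rewrite unitmxE unitfE hA.
have := erefl (z *: (P n *m C + Q n *m D)).
(* The combination P C + Q D solves the recurrence at n. *)
rewrite [in LHS]scalerDr !scalemxAl -(hP n) -(hQ n) -/L !mulmxDl addrACA.
rewrite [X in X + _]addrACA -!mulmxA -!mulmxDr CDW CDX /W mulmxA mulmxV// mul1mx.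
rewrite [X in X + _]addrAC subrK -addrA -[RHS]addr0 => /addrI.
rewrite addrC => /subr0_eq.
by move/(congr1 (mulmx (invmx (A n)))); rewrite !mulKmx.
Qed.

Lemma solutions_not_both0 (R : realType) (d : nat) (hd : (0 < d)%N)
    (A B : nat -> 'M[R[i]]_d)
    (hA : forall n, \det (A n) != 0) (z : R[i]) (P Q : nat -> 'M[R[i]]_d)
    (hP : jacobi_solution A B z 0 P) (hP0 : P 0%N = 1%:M)
    (hQ : jacobi_solution A B z 1%:M Q) (hQ0 : Q 0%N = 0) n :
  (P n != 0) || (Q n != 0).
Proof.
rewrite -negb_and; apply/negP => /andP[/eqP Pn /eqP Qn].
have [C [D [_]]] := solutions_span_data hA hP hP0 hQ hQ0 n 0 1%:M.
rewrite Pn Qn !mul0mx addr0 => /matrixP/(_ (Ordinal hd) (Ordinal hd)).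
by rewrite !mxE eqxx => /esym/eqP; rewrite oner_eq0.
Qed.

Lemma second_kind_at1_neq0 (R : realType) (d : nat) (hd : (0 < d)%N)
    (A B : nat -> 'M[R[i]]_d) (z : R[i]) (Q : nat -> 'M[R[i]]_d)
    (hQ : jacobi_solution A B z 1%:M Q) (hQ0 : Q 0%N = 0) : Q 1%N != 0.
Proof.
apply/eqP => Q1; have := hQ 0%N; rewrite /= hQ0 Q1 !mulmx0 !addr0 scaler0 mulmx1.
move=> /matrixP/(_ (Ordinal hd) (Ordinal hd)).
rewrite !mxE eqxx rmorphN rmorph1 => /eqP.
by rewrite oppr_eq0 oner_eq0.
Qed.

(** * Square summable solutions and self-adjointness *)

Lemma l2_mulmx (R : realType) (d : nat) (X : nat -> 'M[R[i]]_d) (x : 'cV[R[i]]_d) :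
  cvgn (series (fun n => opnorm (X n) ^+ 2)) -> l2 (fun n => X n *m x).
Proof.
move=> cX; rewrite /l2 /=.
apply: (@series_le_cvg _ _ (fun n => vnorm x ^+ 2 * opnorm (X n) ^+ 2)).
- by move=> n; exact: sqr_ge0.
- by move=> n; rewrite mulr_ge0 ?sqr_ge0.
- move=> n; rewrite -exprMn mulrC ler_pXn2r ?nnegrE ?vnorm_ge0 ?vnorm_mulmx_le//.
  by rewrite mulr_ge0 ?opnorm_ge0 ?vnorm_ge0.
- exact: is_cvg_seriesZ.
Qed.

Lemma normr_Re_vdot_le (R : realType) (d : nat) (x y : 'cV[R[i]]_d) :
  `|complex.Re (vdot x y)| <= vnorm x ^+ 2 + vnorm y ^+ 2.
Proof.
rewrite /vdot raddf_sum !sqr_vnorm -big_split/=.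
apply: (le_trans (ler_norm_sum _ _ _)); apply: ler_sum => i _.
case: (x i 0) (y i 0) => [a b] [p q] /=.
rewrite !sqr_sqrtr ?addr_ge0 ?sqr_ge0// ler_norml.
have h1 := sqr_ge0 (a + p); have h2 := sqr_ge0 (a - p).
have h3 := sqr_ge0 (b + q); have h4 := sqr_ge0 (b - q).
have h5 := sqr_ge0 a; have h6 := sqr_ge0 b.
have h7 := sqr_ge0 p; have h8 := sqr_ge0 q.
by apply/andP; split; lra.
Qed.

Lemma cvg_series_Re_vdot (R : realType) (d : nat) (u v : nat -> 'cV[R[i]]_d) :
  l2 u -> l2 v -> cvgn (series (fun n => complex.Re (vdot (u n) (v n)))).
Proof.
move=> l2u l2v; apply: normed_cvg.
apply: (series_le_cvg _ _ (fun n => normr_Re_vdot_le (u n) (v n))) => [n|n|].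
- exact: normr_ge0.
- by rewrite addr_ge0 ?sqr_ge0.
- exact: is_cvg_seriesD.
Qed.

Lemma cvg_series_head (R : realType) (c : R) :
  series (fun n => if n is 0%N then c else 0) n @[n --> \oo] --> c.
Proof.
rewrite -cvg_shiftS; apply: cvg_near_cst; near=> n.
by rewrite /series /= big_nat_recl// big1 ?addr0.
Unshelve. all: by end_near. Qed.

(** The operator has no term of index -1, so the boundary contribution
    A_{-1}^* U_{-1} = - U_{-1} appears as a defect at index 0. *)
Lemma jacobi_solution_mulmx (R : realType) (d : nat) (A B : nat -> 'M[R[i]]_d)
    (z : R[i]) (Um1 : 'M[R[i]]_d) (U : nat -> 'M[R[i]]_d) (x : 'cV[R[i]]_d) n :
  jacobi_solution A B z Um1 U ->
  jacobi A B (fun n => U n *m x) n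
    = z *: (U n *m x) + (if n is 0%N then Um1 *m x else 0).
Proof.
move=> /(_ n) hU; rewrite scalemxAl -hU; case: n hU => [|n] _ /=.
  rewrite linearN/= trmx1 map_mxN map_mx1 mulNmx mul1mx !mulmxDl mulNmx.
  by rewrite !mulmxA -[X in _ = X + _]addrA [RHS]addrAC addNr add0r.
by rewrite addr0 !mulmxDl !mulmxA.
Qed.

Lemma vdotZDr (R : realType) (d : nat) (a : R) (x y w : 'cV[R[i]]_d) :
  vdot x ((a%:C)%C *: y + w) = (a%:C)%C * vdot x y + vdot x w.
Proof.
rewrite /vdot mulr_sumr -big_split/=; apply: eq_bigr => i _.
rewrite !mxE rmorphD rmorphM mulrDr/=; congr (_ + _).
by rewrite mulrCA; congr (_ * _); exact: conjc_real.
Qed.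

Lemma vdotZl (R : realType) (d : nat) (c : R[i]) (x y : 'cV[R[i]]_d) :
  vdot (c *: x) y = c * vdot x y.
Proof.
by rewrite /vdot mulr_sumr; apply: eq_bigr => i _; rewrite mxE mulrA.
Qed.

Lemma vdot0r (R : realType) (d : nat) (x : 'cV[R[i]]_d) : vdot x 0 = 0.
Proof. by rewrite /vdot big1// => i _; rewrite mxE rmorph0 mulr0. Qed.

Lemma Re_vdotxx (R : realType) (d : nat) (x : 'cV[R[i]]_d) :
  complex.Re (vdot x x) = vnorm x ^+ 2.
Proof.
rewrite sqr_vnorm /vdot raddf_sum; apply: eq_bigr => i _.
case: (x i 0) => a b /=; rewrite sqr_sqrtr ?addr_ge0 ?sqr_ge0//.
by rewrite !expr2 mulrN opprK.
Qed.

Lemma jacobi_dom_solution (R : realType) (d : nat) (A B : nat -> 'M[R[i]]_d)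
    (z : R[i]) (Um1 : 'M[R[i]]_d) (U : nat -> 'M[R[i]]_d) (x : 'cV[R[i]]_d) :
  jacobi_solution A B z Um1 U ->
  cvgn (series (fun n => opnorm (U n) ^+ 2)) ->
  jacobi_dom A B (fun n => U n *m x).
Proof.
move=> hU cU; have l2U : l2 (fun n => U n *m x) by exact: l2_mulmx.
split=> //.
set w := jacobi _ _ _.
pose c := ComplexField.Normc.normc z ^+ 2.
apply: (@series_le_cvg _ _ (fun n => c * vnorm (U n *m x) ^+ 2
          + (if n is 0%N then vnorm (w 0%N) ^+ 2 else 0))) => [n|n|[|n]|].
- exact: sqr_ge0.
- apply: addr_ge0; first by rewrite mulr_ge0 /c ?sqr_ge0.
  by case: n => // ; exact: sqr_ge0.
- by rewrite lerDr mulr_ge0 /c ?sqr_ge0.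
- by rewrite /w (jacobi_solution_mulmx _ _ hU) !addr0 vnormZ exprMn /c.
- apply: is_cvg_seriesD; first exact: is_cvg_seriesZ.
  exact: (cvgP _ (@cvg_series_head _ _)).
Qed.

(** A discrete Green identity at the origin: moving the operator from P x to
    Q x in the inner product leaves the boundary term <P_0 x, x>. *)
Lemma selfadjoint_not_both_l2 (R : realType) (d : nat) (hd : (0 < d)%N)
    (A B : nat -> 'M[R[i]]_d)
    (hJ : selfadjoint (jacobi_dom A B) (jacobi A B)) (lambda : R)
    (P Q : nat -> 'M[R[i]]_d)
    (hP : jacobi_solution A B (lambda%:C)%C 0 P) (hP0 : P 0%N = 1%:M)
    (hQ : jacobi_solution A B (lambda%:C)%C 1%:M Q) :
  ~ (cvgn (series (fun n => opnorm (P n) ^+ 2)) /\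
     cvgn (series (fun n => opnorm (Q n) ^+ 2))).
Proof.
case=> cP cQ.
pose x : 'cV[R[i]]_d := delta_mx (Ordinal hd) 0.
pose u n := P n *m x; pose v n := Q n *m x.
have domu : jacobi_dom A B u by exact: jacobi_dom_solution hP cP.
have domv : jacobi_dom A B v by exact: jacobi_dom_solution hQ cQ.
(* Symmetry of the operator on the pair (u, v), of which the real part
   suffices. *)
have [_ _ /(_ u domu)] := (hJ.2 v (jacobi A B v)).1 (conj domv erefl).
move=> /(congr1 (@complex.Re R)) /=.
pose s n := complex.Re (vdot ((lambda%:C)%C *: u n) (v n)).
have cs : cvgn (series s).
  apply: cvg_series_Re_vdot; last exact: domv.1.
  rewrite (_ : (fun n => _) = jacobi A B u); first exact: domu.2.
  apply/funext => n; rewrite (jacobi_solution_mulmx _ _ hP).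
  by case: n => [|n]; rewrite ?mul0mx addr0.
have -> : (fun n => complex.Re (vdot (jacobi A B u n) (v n))) = s.
  apply/funext => n; rewrite (jacobi_solution_mulmx _ _ hP) /s.
  by case: n => [|n]; rewrite ?mul0mx addr0.
have -> : (fun n => complex.Re (vdot (u n) (jacobi A B v n)))
    = s + (fun n => if n is 0%N then vnorm x ^+ 2 else 0).
  apply/funext => n; rewrite (jacobi_solution_mulmx _ _ hQ) vdotZDr raddfD -vdotZl.
  congr (_ + _); case: n => [|n]; last by rewrite vdot0r.
  by rewrite /u hP0 !mul1mx; exact: Re_vdotxx.
rewrite seriesD limD//; last exact: (cvgP _ (@cvg_series_head _ _)).
rewrite (cvg_lim _ (@cvg_series_head _ _))// => /eqP.
rewrite addrC -subr_eq subrr eq_sym sqrf_eq0 => /eqP/vnorm_eq0/colP.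
move=> /(_ (Ordinal hd)) /eqP.
by rewrite !mxE !eqxx/= oner_eq0.
Qed.

(** * The function ell *)

Theorem proposition4p6 (R : realType) (d : nat) (hd : (0 < d)%N)
    (A B : nat -> 'M[R[i]]_d)
    (hA : forall n, \det (A n) != 0)
    (hB : forall n, B n = (B n)^t*)
    (hJ : selfadjoint (jacobi_dom A B) (jacobi A B))
    (lambda : R)
    (P Q : nat -> 'M[R[i]]_d)
    (hP : jacobi_solution A B (lambda%:C)%C 0 P) (hP0 : P 0%N = 1%:M)
    (hQ : jacobi_solution A B (lambda%:C)%C 1%:M Q) (hQ0 : Q 0%N = 0) :
  let is_ell (l : R -> R) :=
    {homo l : eps / 0 < eps} /\
    (forall eps, 0 < eps ->
      interval_norm P (l eps) * interval_norm Q (l eps) = (2 * eps)^-1) in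
  exists l : R -> R,
    [/\ is_ell l,
        forall l' : R -> R, is_ell l' -> {in Num.pos, l' =1 l},
        [/\ {in Num.pos &, {homo l : x y /~ x < y}},
            {within [set x | 0 < x], continuous l},
            l eps @[eps --> 0^'+] --> +oo
          & l eps @[eps --> +oo] --> 0]
      & exists m : R -> R,
          [/\ {homo m : t / 0 < t},
              {in Num.pos, cancel l m} /\ {in Num.pos, cancel m l}
            & [/\ {in Num.pos &, {homo m : x y /~ x < y}},
                  {within [set x | 0 < x], continuous m},
                  m t @[t --> 0^'+] --> +oo
                & m t @[t --> +oo] --> 0]]].
Proof.
move=> is_ell; pose h (t : R) := interval_norm P t * interval_norm Q t.
have P0 : P 0%N != 0.
  by have := solutions_not_both0 hd hA hP hP0 hQ hQ0 0; rewrite hQ0 eqxx orbF.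
have Q1 : Q 1%N != 0 by exact: second_kind_at1_neq0 hQ hQ0.
have hinc : {in Num.nneg &, {homo h : s t / s < t}}.
  apply: (interval_norm_product_increasing P0 Q1) => n.
  exact: (solutions_not_both0 hd hA hP hP0 hQ hQ0 n.+1).
have h0 : h 0 = 0.
  rewrite /h (interval_norm_nat Q 0) big_nat1 hQ0 opnorm0 expr0n sqrtr0.
  by rewrite mulr0.
have hpos t : 0 < t -> 0 < h t.
  by move=> t0; rewrite -h0 hinc// nnegrE// ltW.
have hsurj y : 0 < y -> exists2 t, 0 < t & h t = y.
  apply: surjective_of_unit_intervals => // [n|]; last first.
    apply: interval_norm_product_unbounded => //.
    exact: (selfadjoint_not_both_l2 hd hJ hP hP0 hQ).
  move=> t; apply: (@cvgM R); exact: interval_norm_continuous.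
have hinj s t : 0 <= s -> 0 <= t -> h s = h t -> s = t.
  rewrite -!nnegrE => s0 t0 st; case: (ltgtP s t) => [lt|gt|//].
    by have := hinc _ _ s0 t0 lt; rewrite st ltxx.
  by have := hinc _ _ t0 s0 gt; rewrite st ltxx.
have inv2_gt0 y : 0 < y -> 0 < (2 * y)^-1 :> R.
  by move=> y0; rewrite invr_gt0 mulr_gt0.
have inv2K y : (2 * (2 * y)^-1)^-1 = y :> R.
  by rewrite invfM invrK mulKf// pnatr_eq0.
have /choice[l lP] : forall eps : R, exists t, 0 < eps -> 0 < t /\ h t = (2 * eps)^-1.
  move=> eps; have [e0|e0] := boolP (0 < eps); last by exists 0.
  by have [t t0 ht] := hsurj _ (inv2_gt0 _ e0); exists t.
have lpos : {homo l : eps / 0 < eps} by move=> e /lP[].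
have hl e : 0 < e -> h (l e) = (2 * e)^-1 by move=> /lP[].
pose m (t : R) := (2 * h t)^-1.
have mpos : {homo m : t / 0 < t} by move=> t t0; exact/inv2_gt0/hpos.
have lK : {in Num.pos, cancel l m}.
  by move=> e; rewrite posrE => e0; rewrite /m hl.
have mK : {in Num.pos, cancel m l}.
  move=> t; rewrite posrE => t0.
  by apply: hinj; [exact/ltW/lpos/mpos|exact: ltW|rewrite hl ?mpos// inv2K].
have mdec : {in Num.pos &, {homo m : x y /~ x < y}}.
  move=> s t; rewrite !posrE => s0 t0 st.
  rewrite ltf_pV2 ?posrE; [|exact/mulr_gt0/hpos..].
  rewrite ltr_pM2l; first exact: hinc (ltW t0) (ltW s0) st.
  exact: ltr0Sn.
have ldec := decreasing_cancel lpos mdec lK.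
have [l_lim0 l_limy] := decreasing_bijection_limits lpos mpos ldec mK.
have [m_lim0 m_limy] := decreasing_bijection_limits mpos lpos mdec lK.
exists l; split => //.
- move=> l' [l'pos hl'] e; rewrite posrE => e0.
  by apply: hinj; [exact/ltW/l'pos|exact/ltW/lpos|rewrite hl// -hl'].
- by split=> //; exact: decreasing_bijection_continuous lpos mpos ldec lK mK.
- exists m; split=> //; split=> //.
  exact: decreasing_bijection_continuous mpos lpos mdec mK lK.
Qed.
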